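(* For integers $r,n\ge 0$ let $g_r(n)$ denote the number of permutations in $S_n$ that avoid the generalized pattern $13\text{-}2$ and contain exactly $r$ occurrences of the generalized pattern $12\text{-}3$. Then for every integer $r\ge 0$ there exist polynomials $p_r$ and $q_{r-1}$ with rational coefficients, of degree at most $r$ and at most $r-1$ respectively, such that for all $n\ge 1$ $$g_r(n)=p_r(n)\cdot 2^n+q_{r-1}(n).$$
   Context: $S_n$ is the set of permutations $\pi=\pi_1\pi_2\cdots\pi_n$ of $\{1,\dots,n\}$. An occurrence of a generalized pattern $ab\text{-}c$ (with $abc$ a permutation of $\{1,2,3\}$) in $\pi$ is a pair $(i,j)$ with $i+1<j\le n$ such that $(\pi_i,\pi_{i+1},\pi_j)$ is order-isomorphic to $(a,b,c)$ (so the first two letters are adjacent in $\pi$). $\pi$ avoids the pattern if it has no occurrence of it. Convention: a polynomial of degree at most a negative number is the zero polynomial. *)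

(* Defs.v *)
From mathcomp Require Import all_boot all_order all_fingroup all_algebra.

Set Implicit Arguments.
Unset Strict Implicit.
Unset Printing Implicit Defensive.

Definition order_isomorphic (s t : seq nat) : bool :=
  (size s == size t) &&
  all (fun i => all (fun j => (nth 0 s i < nth 0 s j) == (nth 0 t i < nth 0 t j))
                    (iota 0 (size s)))
      (iota 0 (size s)).

(* Positions and letters of a permutation of 'I_n are numbered from 0 instead
   of 1; occurrences only depend on their relative order.  The index k below
   is the position i + 1, as an element of 'I_n. *)
Definition occurrences (a b c n : nat) (pi : 'S_n) : {set 'I_n * 'I_n} :=
  [set ij : 'I_n * 'I_n |
    [exists k : 'I_n,
      [&& k == ij.1.+1 :> nat, k < ij.2 &
          order_isomorphic [:: val (pi ij.1); val (pi k); val (pi ij.2)]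
                           [:: a; b; c]]]].

Definition avoids (a b c n : nat) (pi : 'S_n) : bool :=
  occurrences a b c pi == set0.

Definition g (r n : nat) : nat :=
  #|[set pi : 'S_n | avoids 1 3 2 pi & #|occurrences 1 2 3 pi| == r]|.

(* Main.v *)
(* A permutation avoids 13-2 iff it is L n R with n its maximum, every letter of
   L larger than every letter of R, and L, R avoiding; then
     occ(L n R) = occ(L) + asc(L) + occ(R),  asc(L n R) = asc(L) + [L nonempty] + asc(R),
   where occ counts 12-3 and asc counts ascents.  Let F_k be the generating
   function in x of the weights q^(occ + k asc).  Then
     F_k = 1 + x F_k + x q^k (F_(k+1) - 1) F_k,
   and for k >= 2 induction on r shows that [q^r] F_k is polynomial in n of degree
   at most r.  For k = 1 the degree is larger, but eliminating F_1 from the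
   equations for k = 0 and k = 1 gives
     (1 - 2x) (F_0 - 1) = x + x q (F_2 - 1) (F_0 - 1),
   so that each further power of q costs one convolution with a coefficient of
   F_2 - 1 and one division by 1 - 2x. *)

Require Import Defs.
From mathcomp Require Import all_boot all_order all_fingroup all_algebra.
From mathcomp Require Import zify ring.

Set Implicit Arguments.
Unset Strict Implicit.
Unset Printing Implicit Defensive.

(** * Pattern occurrences and ascents in words *)

Fixpoint occ (P : nat -> nat -> nat -> bool) (s : seq nat) : nat :=
  if s is x :: s' then
    (if s' is y :: s'' then count (P x y) s'' else 0) + occ P s'
  else 0.

Fixpoint adj (Q : rel nat) (s : seq nat) : nat :=
  if s is x :: s' then
    (if s' is y :: _ then Q x y : nat else 0) + adj Q s'
  else 0.

Definition p132 (x y z : nat) := x < z < y.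
Definition p123 (x y z : nat) := x < y < z.

Lemma eq_occ P P' s : (forall x y z, P x y z = P' x y z) -> occ P s = occ P' s.
Proof.
move=> eqP; elim: s => //= x s ->; case: s => [|y s] //; congr (_ + _).
exact: eq_count.
Qed.

Lemma occ_map P (h : nat -> nat) s :
  (forall x y z, P (h x) (h y) (h z) = P x y z) -> occ P (map h s) = occ P s.
Proof.
move=> hP; elim: s => //= x s ->; case: s => [|y s] //=; congr (_ + _).
by rewrite count_map; apply: eq_count => z /=.
Qed.

Lemma adj_map Q (h : nat -> nat) s :
  (forall x y, Q (h x) (h y) = Q x y) -> adj Q (map h s) = adj Q s.
Proof. by move=> hQ; elim: s => //= x s ->; case: s => [|y s] //=; rewrite hQ. Qed.

(** Links the recursion to pairs of positions, the form in which [occurrences] counts. *)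
Lemma occE P s :
  occ P s = \sum_(i < size s) \sum_(j < size s)
    ((i.+1 < j) && P (nth 0 s i) (nth 0 s i.+1) (nth 0 s j)).
Proof.
elim: s => [|x s IHs]; first by rewrite big_ord0.
rewrite /= big_ord_recl; congr (_ + _).
  case: s {IHs} => [|y s] /=; first by rewrite big_ord_recl big_ord0.
  rewrite big_ord_recl big_ord_recl !add0n -sum1_count big_mkcond.
  by rewrite (big_nth 0) big_mkord; apply: eq_bigr => i _ /=; case: ifP.
rewrite IHs; apply: eq_bigr => i _; rewrite big_ord_recl add0n.
by apply: eq_bigr => j _; rewrite /= !/bump /=.
Qed.

(** * Splitting a word at its maximum *)

(** The hypotheses exclude a third letter in [R] when the adjacent pair starts in [L] or at [m]; the
    middle term collects the occurrences ending at [m]. *)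
Lemma occ_cat P (m : nat) (L R : seq nat) :
    (forall x y z, x \in L -> z \in R -> P x y z = false) ->
    (forall y z, z \in R -> P m y z = false) ->
  occ P (L ++ m :: R) = occ P L + adj (fun x y => P x y m) L + occ P R.
Proof.
move=> PL Pm; elim: L PL => [|x L IHL] PL.
  case: R Pm {PL} => //= y R Pm; rewrite (eq_in_count (a2 := pred0)).
    by rewrite count_pred0.
  by move=> z zR; rewrite Pm // in_cons zR orbT.
rewrite /= IHL; last by move=> u y z uL; apply: PL; rewrite in_cons uL orbT.
have nP y : count (P x y) R = 0.
  rewrite (eq_in_count (a2 := pred0)) ?count_pred0 // => z zR.
  by rewrite PL ?mem_head.
case: L {IHL PL} => [|y L] /=; first by rewrite nP.
by rewrite count_cat /= nP; lia.
Qed.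

(* Walking from a letter x < z of L to the maximum m, some ascent jumps over z. *)
Lemma occ_eq0_gt (m : nat) (L R : seq nat) z :
    z \in R -> z < m -> z \notin L -> occ p132 (L ++ m :: R) = 0 ->
  all (fun x => z < x) L.
Proof.
move=> zR zm; elim: L => // x [|y L] IHL /=.
  move=> zx /eqP; rewrite !addn_eq0 => /andP[c0 _].
  rewrite andbT; move: c0; rewrite -leqn0 leqNgt -has_count.
  move=> /hasPn/(_ z zR); rewrite /p132 zm andbT -leqNgt => ?.
  by move: zx; rewrite inE; lia.
rewrite inE negb_or => /andP[zx zL] /eqP; rewrite addn_eq0 => /andP[c0 /eqP o0].
have /= /andP[zy ->] := IHL zL o0; rewrite zy !andbT.
move: c0; rewrite -leqn0 leqNgt -has_count => /hasPn/(_ z).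
rewrite mem_cat in_cons zR !orbT /p132 zy andbT => /(_ isT).
by move: zx; lia.
Qed.

Lemma adj_pred0 (Q : rel nat) s :
  (forall x y, x \in s -> y \in s -> Q x y = false) -> adj Q s = 0.
Proof.
elim: s => //= x s IHs Q0.
rewrite IHs => [|u v us vs]; last by rewrite Q0 // in_cons ?us ?vs orbT.
case: s {IHs} Q0 => //= y s Q0.
by rewrite Q0 // !in_cons eqxx ?orbT.
Qed.

Lemma eq_in_adj (Q Q' : rel nat) s :
  {in s &, Q =2 Q'} -> adj Q s = adj Q' s.
Proof.
elim: s => //= x s IHs QQ'.
rewrite IHs => [|u v us vs]; last by rewrite QQ' // in_cons ?us ?vs orbT.
case: s {IHs} QQ' => //= y s QQ'.
by rewrite QQ' // !in_cons eqxx ?orbT.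
Qed.

Section Split.
Variables (m : nat) (L R : seq nat).
Hypotheses (Lm : forall x, x \in L -> x < m) (Rm : forall z, z \in R -> z < m).
Hypothesis RL : forall x z, x \in L -> z \in R -> z < x.

Lemma occ132_split : occ p132 (L ++ m :: R) = occ p132 L + occ p132 R.
Proof.
rewrite occ_cat; first 1 last.
- by move=> x y z xL zR; have := RL xL zR; rewrite /p132; lia.
- by move=> y z zR; have := Rm zR; rewrite /p132; lia.
(* The maximum [m] cannot play the 2 of 13-2. *)
by rewrite adj_pred0 ?addn0 // => x y xL yL; have := Lm yL; rewrite /p132; lia.
Qed.

(** As third letter, [m] completes every ascent of [L] to an occurrence of 12-3. *)
Lemma occ123_split :
  occ p123 (L ++ m :: R) = occ p123 L + adj ltn L + occ p123 R.
Proof.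
rewrite occ_cat; first 1 last.
- by move=> x y z xL zR; have := RL xL zR; rewrite /p123; lia.
- by move=> y z zR; have := Rm zR; rewrite /p123; lia.
congr (_ + _ + _); apply: eq_in_adj => x y xL yL; rewrite /p123 /=.
by have := Lm yL; lia.
Qed.

(** The step from the last letter of [L] up to [m] is the only new ascent; the step from [m] into
    [R] goes down. *)
Lemma asc_split :
  adj ltn (L ++ m :: R) = adj ltn L + (L != [::]) + adj ltn R.
Proof.
have aR : adj ltn (m :: R) = adj ltn R.
  case: R Rm => //= y R' /(_ y (mem_head _ _)) ym.
  by rewrite ltnNge ltnW.
clear Rm RL; elim: L Lm => [|x L' IHL] L'm; first by rewrite cat0s aR.
have := IHL (fun y yL => L'm y (@mem_behead _ (x :: L') y yL)).
have := L'm x (mem_head _ _).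
case: {IHL L'm} L' => [|y L'] /= xm; first by rewrite xm !add0n => ->.
by move=> ->; lia.
Qed.

End Split.

(** * Permutations as words *)

Definition word n (pi : 'S_n) : seq nat := [seq val (pi i) | i <- enum 'I_n].

Lemma nth_word n (pi : 'S_n) (i : 'I_n) : nth 0 (word pi) i = pi i.
Proof. by rewrite (nth_map i) ?size_enum_ord // nth_ord_enum. Qed.

Lemma size_word n (pi : 'S_n) : size (word pi) = n.
Proof. by rewrite size_map size_enum_ord. Qed.

Lemma word_inj n : injective (@word n).
Proof.
move=> pi rho eqw; apply/permP => i; apply: val_inj.
by rewrite /= -!nth_word eqw.
Qed.

Lemma perm_words n :
  perm_eq [seq word pi | pi <- enum 'S_n] (permutations (iota 0 n)).
Proof.
have uw : uniq [seq word pi | pi <- enum 'S_n].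
  by rewrite (map_inj_uniq (@word_inj n)) enum_uniq.
have sub : {subset [seq word pi | pi <- enum 'S_n] <= permutations (iota 0 n)}.
  move=> _ /mapP[pi _ ->]; rewrite mem_permutations.
  have uwp : uniq (word pi).
    by rewrite map_inj_uniq ?enum_uniq //; apply: inj_comp val_inj perm_inj.
  have swp : {subset word pi <= iota 0 n}.
    by move=> _ /mapP[i _ ->]; rewrite mem_iota ltn_ord.
  have [|_ eqm] := uniq_min_size uwp swp; first by rewrite size_word size_iota.
  by apply: uniq_perm => //; apply: iota_uniq.
(* Both lists have n! entries, so the inclusion of one in the other is an equality. *)
have [|_ eqm] := uniq_min_size uw sub.
  rewrite size_permutations ?iota_uniq // size_map -cardE size_iota.
  by rewrite card_Sn.
by apply: uniq_perm => //; apply: permutations_uniq.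
Qed.

Lemma card_occurrences a b c n (pi : 'S_n) :
  #|occurrences a b c pi| =
  occ (fun x y z => order_isomorphic [:: x; y; z] [:: a; b; c]) (word pi).
Proof.
rewrite occE size_word pair_big /= -sum1_card big_mkcond /=.
apply: eq_bigr => [[i j] _]; rewrite inE /= !nth_word.
set e := (if _ then _ else _); set e' := _ && _.
suff: [exists k : 'I_n, [&& k == i.+1 :> nat, k < j &
    order_isomorphic [:: val (pi i); val (pi k); val (pi j)] [:: a; b; c]]] = e'.
  by rewrite {}/e => ->; case: e'.
rewrite {e}/e'; apply/existsP/andP => [[k /and3P[/eqP ki kj ok]]|[ij ok]].
  by rewrite -ki nth_word.
pose k := Ordinal (ltn_trans ij (ltn_ord j)).
by exists k; rewrite /= eqxx ij -(nth_word pi k).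
Qed.

Lemma card_occurrences132 n (pi : 'S_n) :
  #|occurrences 1 3 2 pi| = occ p132 (word pi).
Proof.
rewrite card_occurrences; apply: eq_occ => x y z.
by rewrite /order_isomorphic /p132 /=; lia.
Qed.

Lemma card_occurrences123 n (pi : 'S_n) :
  #|occurrences 1 2 3 pi| = occ p123 (word pi).
Proof.
rewrite card_occurrences; apply: eq_occ => x y z.
by rewrite /order_isomorphic /p123 /=; lia.
Qed.

(** * Avoiders and the position of their maximum *)

Definition avoiders n : seq (seq nat) :=
  [seq s <- permutations (iota 0 n) | occ p132 s == 0].

Lemma gE r n : g r n = count (fun s => occ p123 s == r) (avoiders n).
Proof.
rewrite /g count_filter -(seq.permP (perm_words n)) count_map.
rewrite cardE {1}/enum_mem size_filter enumT.
apply: eq_count => pi; rewrite !inE /avoids -cards_eq0.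
by rewrite card_occurrences132 card_occurrences123 andbC.
Qed.

Lemma mem_avoiders n s :
  (s \in avoiders n) = perm_eq s (iota 0 n) && (occ p132 s == 0).
Proof. by rewrite mem_filter mem_permutations andbC. Qed.

Lemma avoiders_uniq n : uniq (avoiders n).
Proof. exact/filter_uniq/permutations_uniq. Qed.

(** The sorted [R] followed by the sorted [L] is sorted, hence is [iota 0 n]; cutting it after
    [size R] entries separates the two value intervals. *)
Lemma perm_split n (L R : seq nat) :
    perm_eq (L ++ R) (iota 0 n) ->
    (forall x z, x \in L -> z \in R -> z < x) ->
  perm_eq R (iota 0 (size R)) /\ perm_eq L (iota (size R) (size L)).
Proof.
move=> pLR RL.
have szn : n = size R + size L.
  by have /perm_size := pLR; rewrite size_cat size_iota addnC => ->.
have srt : sorted leq (sort leq R ++ sort leq L).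
  rewrite (sorted_pairwise leq_trans) pairwise_cat.
  rewrite -!(sorted_pairwise leq_trans) !(sort_sorted leq_total) !andbT.
  by apply/allrelP => z x; rewrite !mem_sort => zR xL; exact/ltnW/RL.
have eqs : sort leq R ++ sort leq L = iota 0 n.
  apply: (sorted_eq leq_trans anti_leq srt (iota_sorted _ _)).
  rewrite (permPl (_ : perm_eq _ (R ++ L))); first by rewrite perm_catC.
  by apply: perm_cat; rewrite perm_sort.
move/eqP: eqs; rewrite szn iotaD eqseq_cat ?size_sort ?size_iota // add0n.
case/andP => /eqP <- /eqP <-.
by rewrite ![perm_eq _ (sort _ _)]perm_sym !perm_sort.
Qed.

(** The maximum [n] stands at position [i]. For [L] a word on the first [i] values and [R] one on
    the first [n - i], the shift lifts [L] just above [R]. *)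
Definition glue n i (L R : seq nat) := map (addn (n - i)) L ++ n :: R.

Section Glue.
Variables (n i : nat) (L R : seq nat).
Hypotheses (le_in : i <= n).
Hypotheses (pL : perm_eq L (iota 0 i)) (pR : perm_eq R (iota 0 (n - i))).

Let Lm x : x \in map (addn (n - i)) L -> x < n.
Proof. by case/mapP => y; rewrite (perm_mem pL) mem_iota => yi ->; lia. Qed.

Let Rm z : z \in R -> z < n.
Proof. by rewrite (perm_mem pR) mem_iota; lia. Qed.

Let RL x z : x \in map (addn (n - i)) L -> z \in R -> z < x.
Proof.
by case/mapP => y _ ->; rewrite (perm_mem pR) mem_iota; lia.
Qed.

Lemma perm_glue : perm_eq (glue n i L R) (iota 0 n.+1).
Proof.
rewrite -addn1 iotaD /glue -cat1s perm_catCA perm_sym perm_catC perm_cat2l.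
rewrite perm_sym perm_catC -{2}(subnK le_in) iotaD; apply: perm_cat => //.
by rewrite addnC iotaDl perm_map.
Qed.

Lemma occ132_glue : occ p132 (glue n i L R) = occ p132 L + occ p132 R.
Proof.
by rewrite occ132_split // occ_map // => x y z; rewrite /p132 !ltn_add2l.
Qed.

Lemma occ123_glue :
  occ p123 (glue n i L R) = occ p123 L + adj ltn L + occ p123 R.
Proof.
rewrite occ123_split // occ_map => [|x y z]; last by rewrite /p123 !ltn_add2l.
by rewrite adj_map // => x y; rewrite /= ltn_add2l.
Qed.

Lemma asc_glue :
  adj ltn (glue n i L R) = adj ltn L + (0 < i) + adj ltn R.
Proof.
rewrite asc_split // adj_map => [|x y]; last by rewrite /= ltn_add2l.
by rewrite -!size_eq0 size_map (perm_size pL) size_iota lt0n.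
Qed.

Lemma index_glue : index n (glue n i L R) = i.
Proof.
rewrite /glue index_cat ifN /= ?eqxx ?addn0 ?size_map ?(perm_size pL) ?size_iota //.
by apply/negP => /Lm; rewrite ltnn.
Qed.

End Glue.

Lemma glue_inj n i (L1 R1 L2 R2 : seq nat) :
  size L1 = size L2 -> glue n i L1 R1 = glue n i L2 R2 -> (L1, R1) = (L2, R2).
Proof.
move=> szL /eqP; rewrite eqseq_cat ?size_map // eqseq_cons eqxx /=.
by case/andP=> /eqP/(inj_map (@addnI _)) -> /eqP ->.
Qed.

(** Cutting at the maximum inverts [glue], and [occ132_glue] makes avoidance of the whole equivalent
    to avoidance of both factors. *)
Lemma avoiders_index n i : i <= n ->
  perm_eq [seq s <- avoiders n.+1 | index n s == i]
          [seq glue n i L R | L <- avoiders i, R <- avoiders (n - i)].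
Proof.
move=> le_in; apply: uniq_perm.
- exact/filter_uniq/avoiders_uniq.
- apply: allpairs_uniq; [exact: avoiders_uniq | exact: avoiders_uniq |].
  move=> _ _ /allpairsP[[L1 R1] [/= L1i _ ->]] /allpairsP[[L2 R2] [/= L2i _ ->]].
  apply: glue_inj; move: L1i L2i; rewrite !mem_avoiders.
  by move=> /andP[/perm_size -> _] /andP[/perm_size -> _].
move=> s; rewrite mem_filter mem_avoiders.
apply/andP/allpairsP => [[/eqP si /andP[ps /eqP os]]|[[L R] [/= Li Rni ->]]]; last first.
  move: Li Rni; rewrite !mem_avoiders => /andP[pL /eqP oL] /andP[pR /eqP oR].
  by rewrite index_glue // perm_glue // occ132_glue // oL oR !eqxx.
have ns : n \in s by rewrite (perm_mem ps) mem_iota /=.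
have us : uniq s by rewrite (perm_uniq ps) iota_uniq.
case/splitPr: ns us si ps os => L R us si ps os.
have nL : n \notin L by move: us; rewrite cat_uniq /= => /and3P[_ /norP[]].
have szL : size L = i by move: si; rewrite index_cat (negPf nL) /= eqxx addn0.
have pLR : perm_eq (L ++ R) (iota 0 n).
  rewrite -(perm_cons n) -[n :: _ ++ _]cat1s perm_catCA (permPl ps).
  by rewrite -addn1 iotaD -[n :: _]cat1s perm_catC.
(* Here avoidance of 13-2 forces [L] to lie above [R]. *)
have RL x z : x \in L -> z \in R -> z < x.
  move=> xL zR; suff /allP : all (fun x => z < x) L by apply.
  apply: (occ_eq0_gt zR _ _ os).
    by have := perm_mem pLR z; rewrite mem_cat zR orbT mem_iota => /esym.
  apply/negP => zL; move: us; rewrite cat_uniq /= => /and3P[_ /norP[_ /hasPn]].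
  by move=> /(_ z zR); rewrite /= zL.
have [pR pL] := perm_split pLR RL.
have szR : size R = n - i.
  by have /perm_size := pLR; rewrite size_cat size_iota -szL => <-; rewrite addKn.
rewrite szR szL in pR pL.
have pL' : perm_eq [seq x - (n - i) | x <- L] (iota 0 i).
  rewrite -[iota 0 i](mapK (addKn (n - i))) -iotaDl addn0.
  exact: perm_map.
have sE : L ++ n :: R = glue n i [seq x - (n - i) | x <- L] R.
  rewrite /glue -map_comp map_id_in // => x; rewrite (perm_mem pL) mem_iota /=.
  by lia.
exists ([seq x - (n - i) | x <- L], R); split=> //=; rewrite mem_avoiders.
  by rewrite pL' /=; move: os; rewrite sE occ132_glue //; lia.
by rewrite pR /=; move: os; rewrite sE occ132_glue //; lia.
Qed.

(** * Generating polynomials and their recurrences *)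

Import GRing.Theory Num.Theory.
Local Open Scope ring_scope.

(* The exponent of the ascents is k because an ascent left of the maximum
   creates one more occurrence of 12-3: k then becomes k + 1. *)
Definition avoider_gf k n : {poly rat} :=
  \sum_(s <- avoiders n) 'X^(occ p123 s + k * adj ltn s).

Lemma gf_empty k : avoider_gf k 0 = 1.
Proof. by rewrite /avoider_gf big_seq1 muln0 expr0. Qed.

Lemma coef_gf_g r n : (avoider_gf 0 n)`_r = (g r n)%:R.
Proof.
rewrite gE /avoider_gf coef_sum -sum1_count natr_sum [RHS]big_mkcond /=.
by apply: eq_bigr => s _; rewrite mul0n addn0 coefXn eq_sym; case: eqP.
Qed.

(** Sorting avoiders by the position [i] of the maximum, the exponent splits into occ(L) + (k+1)
    asc(L), k [i > 0] and occ(R) + k asc(R). *)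
Lemma gf_glue k n :
  avoider_gf k n.+1 =
    \sum_(i < n.+1) 'X^(k * (0 < i)) * avoider_gf k.+1 i * avoider_gf k (n - i).
Proof.
(* The default of [inord] is never reached: [n] occurs in every avoider of length n + 1. *)
pose p s : 'I_n.+1 := inord (index n s).
rewrite /avoider_gf (partition_big p xpredT) //=; apply: eq_bigr => i _.
have le_in : (i <= n)%N by rewrite -ltnS.
rewrite big_seq_cond (eq_bigl (fun s => (s \in avoiders n.+1) && (index n s == i))).
  rewrite -big_seq_cond -big_filter (perm_big _ (avoiders_index le_in)) /=.
  rewrite big_allpairs_dep /= -mulrA mulr_suml mulr_sumr big_seq [RHS]big_seq.
  apply: eq_bigr => L; rewrite mem_avoiders => /andP[pL _].
  rewrite !mulr_sumr big_seq [RHS]big_seq.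
  apply: eq_bigr => R; rewrite mem_avoiders => /andP[pR _].
  by rewrite occ123_glue // asc_glue // -!exprD; congr ('X^ _); lia.
move=> s; case sA: (s \in _) => //=; rewrite -val_eqE /= inordK //.
move: sA; rewrite mem_avoiders => /andP[ps _].
have := perm_size ps; rewrite size_iota => <-.
by rewrite index_mem (perm_mem ps) mem_iota /=.
Qed.

(* The coefficient of x^n in x f(x) h(x). *)
Definition cauchy (R : pzSemiRingType) (f h : nat -> R) n : R :=
  \sum_(l < n) f l * h (n.-1 - l)%N.

(** The first term is the case of an empty left factor, where no ascent leads up to the maximum. *)
Lemma gf_rec k n :
  avoider_gf k n.+1 =
    avoider_gf k n + 'X^k * cauchy (fun l => avoider_gf k.+1 l.+1) (avoider_gf k) n.
Proof.
rewrite gf_glue big_ord_recl muln0 expr0 mul1r gf_empty mul1r subn0 mulr_sumr.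
congr (_ + _); apply: eq_bigr => i _; rewrite /= /bump /= !add1n muln1 mulrA.
by congr (_ * avoider_gf k _); lia.
Qed.

Lemma cauchyE (R : pzSemiRingType) (f h : nat -> R) n :
  cauchy f h n = \sum_(0 <= l < n) f l * h (n.-1 - l)%N.
Proof. by rewrite big_mkord. Qed.

(** For k = 0 the empty left factor needs no separate term. At index 0 the convolution is 0 but the
    polynomial is 1, hence the successor. *)
Lemma gf0_cauchy n : avoider_gf 0 n.+1 = cauchy (avoider_gf 1) (avoider_gf 0) n.+1.
Proof.
rewrite gf_glue; apply: eq_bigr => i _.
by rewrite mul0n expr0 mul1r.
Qed.

(** Both sides sum over triples of indices with total n - 2. *)
Lemma cauchyA (R : pzSemiRingType) (f h e : nat -> R) n :
  cauchy f (cauchy h e) n = cauchy (cauchy f h) e n.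
Proof.
rewrite !cauchyE; under [RHS]eq_big_nat => m /andP[_ mn].
  rewrite cauchyE mulr_suml (big_nat_widen _ _ n) 1?ltnW //=; over.
rewrite (exchange_big_dep_nat xpredT) //=; apply: eq_big_nat => l /andP[_ ln].
rewrite cauchyE mulr_sumr -(big_nat_widenl l.+1 0 n xpredT) // -[l.+1]add0n big_addn.
rewrite (_ : n - l.+1 = n.-1 - l)%N; last by lia.
apply: eq_big_nat => m mn; rewrite mulrA; congr (_ * h _ * e _); lia.
Qed.

Lemma cauchyDl (R : pzSemiRingType) (c : R) (u v w : nat -> R) n :
  cauchy (fun l => u l + c * v l) w n = cauchy u w n + c * cauchy v w n.
Proof.
rewrite /cauchy mulr_sumr -big_split; apply: eq_bigr => i _.
by rewrite /= mulrDl mulrA.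
Qed.

(* Eliminates avoider_gf 1, whose coefficients grow too fast in degree, from
   the recurrences for avoider_gf 0 and avoider_gf 1. *)
Lemma gf0_rec n :
  avoider_gf 0 n.+2 = 2%:R * avoider_gf 0 n.+1
    + 'X * cauchy (fun l => avoider_gf 2 l.+1) (fun l => avoider_gf 0 l.+1) n.
Proof.
have split1 : avoider_gf 0 n.+2 =
    avoider_gf 0 n.+1 + cauchy (fun l => avoider_gf 1 l.+1) (avoider_gf 0) n.+1.
  by rewrite gf0_cauchy /cauchy big_ord_recl gf_empty mul1r subn0; congr (_ + _).
(* Inserts the recurrence for k = 1 into the left factor. *)
have split2 : cauchy (fun l => avoider_gf 1 l.+1) (avoider_gf 0) n.+1 =
    cauchy (avoider_gf 1) (avoider_gf 0) n.+1
    + 'X * cauchy (cauchy (fun l => avoider_gf 2 l.+1) (avoider_gf 1))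
                  (avoider_gf 0) n.+1.
  rewrite -cauchyDl; apply: eq_bigr => i _ /=.
  by rewrite gf_rec expr1.
(* After reassociation, [avoider_gf 1] occurs only convolved with [avoider_gf 0], which [gf0_cauchy]
   folds back. *)
rewrite split1 split2 -gf0_cauchy -cauchyA mulr_natl mulr2n addrA; congr (_ + _ * _).
(* The last term contains an empty convolution and vanishes. *)
rewrite {1}/cauchy big_ord_recr /= subnn {2}/cauchy big_ord0 mulr0 addr0.
apply: eq_bigr => l _; rewrite (gf0_cauchy (n.-1 - l)).
by rewrite (_ : (n.-1 - l).+1 = n - l)%N //; have := ltn_ord l; lia.
Qed.

Definition gf_coef k r n : rat := (avoider_gf k n)`_r.

Lemma coef_cauchy (p q : nat -> {poly rat}) r n :
  (cauchy p q n)`_r =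
    \sum_(a < r.+1) cauchy (fun n => (p n)`_a) (fun n => (q n)`_(r - a)) n.
Proof.
rewrite coef_sum exchange_big; apply: eq_bigr => l _ /=.
exact: coefM.
Qed.

(** * Difference equations for polynomials *)

Section Pol.
Variable R : numFieldType.
Implicit Types (p q : {poly R}).

Definition delta p : {poly R} := p \Po ('X + 1) - p.

Lemma deltaD p q : delta (p + q) = delta p + delta q.
Proof. by rewrite /delta comp_polyD opprD addrACA. Qed.

Lemma deltaZ c p : delta (c *: p) = c *: delta p.
Proof. by rewrite /delta comp_polyZ scalerBr. Qed.

Lemma delta_horner p n : (delta p).[n%:R] = p.[n.+1%:R] - p.[n%:R].
Proof. by rewrite !hornerE horner_comp !hornerE -natr1. Qed.

(** The shift keeps the degree and the leading coefficient, so the top terms cancel. *)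
Lemma size_delta p : (size (delta p) <= (size p).-1)%N.
Proof.
have szX : size ('X + 1 : {poly R}) = 2 by rewrite size_XaddC.
have szp : size (p \Po ('X + 1)) = size p by rewrite size_comp_poly2.
apply/leq_sizeP => j lej; rewrite coefB.
have [->|nej] := eqVneq j (size p).-1; last first.
  have lej' : (size p <= j)%N.
    by clear szX szp; move: lej nej; case: (size p) => [|k] /=; lia.
  by rewrite !nth_default ?subrr ?szp.
have := @lead_coef_comp R p ('X + 1).
rewrite szX => /(_ isT); rewrite /lead_coef szp => ->.
have -> : ('X + 1 : {poly R})`_(size ('X + 1 : {poly R})).-1 = 1.
  by rewrite szX coefD coefX coef1 addr0.
by rewrite expr1n mulr1 subrr.
Qed.

(** [delta] lowers the degree, so 1 + c delta is inverted by a terminating Neumann series. *)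
Lemma solve_shift c p : exists2 P : {poly R}, (size P <= size p)%N & P + c *: delta P = p.
Proof.
have [d led] := ubnP (size p); elim: d p led => // d IHd p led.
have [->|p0] := eqVneq p 0.
  by exists 0; rewrite // /delta comp_poly0 subr0 scaler0 addr0.
have szd : (size (- c *: delta p) <= (size p).-1)%N.
  exact: leq_trans (size_scale_leq _ _) (size_delta p).
have szp : (0 < size p)%N by rewrite size_poly_gt0.
have [|P szP eqP] := IHd (- c *: delta p).
  by rewrite (leq_ltn_trans szd) // prednK // -ltnS.
exists (p + P).
  rewrite (leq_trans (size_polyD _ _)) // geq_max leqnn.
  by rewrite (leq_trans szP) // (leq_trans szd) ?leq_pred.
by rewrite deltaD scalerDr addrACA eqP scaleNr addrK.
Qed.

Lemma size_deltaXn (d : nat) :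
  (size (delta 'X^(d.+1) - d.+1%:R *: 'X^d)%R <= d)%N.
Proof.
rewrite /delta comp_Xn_poly exprD1n !big_ord_recr /= binn binSn.
rewrite scaler_nat mulr1n !addrK.
apply: (leq_trans (size_sum _ _ _)); apply/bigmax_leqP => i _.
by rewrite -scaler_nat (leq_trans (size_scale_leq _ _)) // size_polyXn.
Qed.

(** Discrete integration: the top term is removed first, then the remainder of lower degree is
    handled by induction. *)
Lemma solve_delta p : exists2 P : {poly R}, (size P <= (size p).+1)%N & delta P = p.
Proof.
suff H d : (size p <= d)%N -> exists2 P : {poly R}, (size P <= d.+1)%N & delta P = p.
  exact: H.
elim: d p => [|d IHd] p lep.
  move: lep; rewrite size_poly_leq0 => /eqP ->.
  by exists 0; rewrite ?size_poly0 // /delta comp_poly0 subr0.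
(* The difference of X^(d+1) has leading term (d+1) X^d, whence this coefficient. *)
pose P0 : {poly R} := (p`_d / d.+1%:R) *: 'X^(d.+1).
have szP0 : (size P0 <= d.+2)%N by rewrite (leq_trans (size_scale_leq _ _)) ?size_polyXn.
have [|P szP eqP] := IHd (p - delta P0).
  have -> : p - delta P0 = (p - p`_d *: 'X^d) -
      (p`_d / d.+1%:R) *: (delta 'X^(d.+1) - d.+1%:R *: 'X^d : {poly R}).
    rewrite /P0 deltaZ [X in _ = _ - X]scalerBr scalerA divfK ?pnatr_eq0 //.
    by rewrite opprB addrA subrK.
  rewrite (leq_trans (size_polyD _ _)) // geq_max size_polyN.
  rewrite (leq_trans (size_scale_leq _ _) (size_deltaXn _)) andbT.
  apply/leq_sizeP => j; rewrite leq_eqVlt => /orP[/eqP<-|ltj].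
    by rewrite coefB coefZ coefXn eqxx mulr1 subrr.
  rewrite coefB coefZ coefXn gtn_eqF // mulr0 subr0 nth_default //.
  exact: leq_trans ltj.
exists (P0 + P); last by rewrite deltaD eqP addrC subrK.
by rewrite (leq_trans (size_polyD _ _)) // geq_max szP0 ltnW.
Qed.
End Pol.

(** * Sequences of the form p(n) 2^n + q(n) *)

(** The bounds are on sizes, so a degree is strictly below its bound; [quasipoly 0 b] means
    polynomial of degree less than [b]. *)
Definition quasipoly a b (f : nat -> rat) :=
  exists p q : {poly rat}, [/\ (size p <= a)%N, (size q <= b)%N &
    forall n, f n = p.[n%:R] * 2%:R ^+ n + q.[n%:R]].

Lemma eq_quasipoly a b f h : f =1 h -> quasipoly a b f -> quasipoly a b h.
Proof. by move=> fh [p [q [sp sq fE]]]; exists p, q; split=> // n; rewrite -fh. Qed.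

Lemma quasipoly_le a b a' b' f :
  (a <= a')%N -> (b <= b')%N -> quasipoly a b f -> quasipoly a' b' f.
Proof.
move=> aa' bb' [p [q [sp sq fE]]].
by exists p, q; split; [exact: leq_trans aa' | exact: leq_trans bb' |].
Qed.

Lemma quasipoly0 a b : quasipoly a b (fun=> 0).
Proof. by exists 0, 0; rewrite size_poly0; split=> // n; rewrite horner0 mul0r addr0. Qed.

Lemma quasipolyD a b f h :
  quasipoly a b f -> quasipoly a b h -> quasipoly a b (fun n => f n + h n).
Proof.
move=> [p [q [sp sq fE]]] [p' [q' [sp' sq' hE]]]; exists (p + p'), (q + q'); split.
- by rewrite (leq_trans (size_polyD _ _)) // geq_max sp.
- by rewrite (leq_trans (size_polyD _ _)) // geq_max sq.
- by move=> n; rewrite fE hE !hornerD; ring.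
Qed.

Lemma quasipolyZ a b c f : quasipoly a b f -> quasipoly a b (fun n => c * f n).
Proof.
move=> [p [q [sp sq fE]]]; exists (c *: p), (c *: q); split.
- exact: leq_trans (size_scale_leq _ _) sp.
- exact: leq_trans (size_scale_leq _ _) sq.
- by move=> n; rewrite fE !hornerZ; ring.
Qed.

Lemma quasipoly_sum a b m (f : 'I_m -> nat -> rat) :
  (forall i, quasipoly a b (f i)) -> quasipoly a b (fun n => \sum_i f i n).
Proof.
elim: m f => [|m IHm] f fP.
  by apply: eq_quasipoly (quasipoly0 a b) => n; rewrite big_ord0.
apply: (@eq_quasipoly _ _ (fun n => f ord0 n + \sum_i f (lift ord0 i) n)).
  by move=> n; rewrite big_ord_recl.
by apply: quasipolyD => //; apply: IHm.
Qed.

(** The difference of P(n) 2^n is (P + 2 delta P)(n) 2^n, solvable without raising the degree; only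
    the polynomial part gains one. A constant fits the initial value. *)
Lemma quasipoly_recur1 a b f h :
  (forall n, f n.+1 = f n + h n) -> quasipoly a b h -> quasipoly a b.+1 f.
Proof.
move=> fS [p [q [sp sq hE]]].
have [P szP eqP] := solve_shift 2%:R p.
have [Q szQ eqQ] := solve_delta q.
exists P, (Q + (f 0%N - P.[0%:R] - Q.[0%:R])%:P); split.
- exact: leq_trans sp.
- rewrite (leq_trans (size_polyD _ _)) // geq_max (leq_trans szQ) //=.
  exact: leq_trans (size_polyC_leq1 _) _.
elim=> [|n IHn]; first by rewrite hornerD hornerC expr0; ring.
rewrite fS hE IHn -{}eqP -{}eqQ.
rewrite !(delta_horner, hornerD, hornerN, hornerZ, hornerC).
rewrite exprS; ring.
Qed.

(** Under f(n+1) - 2 f(n), the term P(n) 2^n becomes 2 (delta P)(n) 2^n and Q becomes delta Q - Q,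
    so now only the exponential part gains a degree. *)
Lemma quasipoly_recur2 a b f h :
  (forall n, f n.+1 = 2%:R * f n + h n) -> quasipoly a b h -> quasipoly a.+1 b f.
Proof.
move=> fS [p [q [sp sq hE]]].
have [P szP eqP] := solve_delta (2%:R^-1 *: p).
have [Q szQ eqQ] := solve_shift (-1) (- q).
rewrite size_polyN in szQ.
exists (P + (f 0%N - P.[0%:R] - Q.[0%:R])%:P), Q; split.
- rewrite (leq_trans (size_polyD _ _)) // geq_max (leq_trans szP) /=.
    exact: leq_trans (size_polyC_leq1 _) _.
  by rewrite ltnS (leq_trans (size_scale_leq _ _)).
- exact: leq_trans sq.
have pE : p = 2%:R *: delta P by rewrite eqP scalerA divff // scale1r.
have qE : q = delta Q - Q by rewrite -[q]opprK -eqQ scaleN1r opprB addrC.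
elim=> [|n IHn]; first by rewrite hornerD hornerC expr0; ring.
rewrite fS hE IHn pE qE !(delta_horner, hornerD, hornerN, hornerZ, hornerC).
rewrite exprS; ring.
Qed.

Lemma quasipoly_diff b f :
  quasipoly 0 b f -> quasipoly 0 b.-1 (fun n => f n.+1 - f n).
Proof.
move=> [p [q []]]; rewrite size_poly_leq0 => /eqP -> sq fE.
exists 0, (delta q); split; rewrite ?size_poly0 //.
  by rewrite (leq_trans (size_delta _)) // -!subn1 leq_sub2r.
by move=> n; rewrite !fE delta_horner !horner0; ring.
Qed.

(** The difference in [n] falls on the left factor, with a boundary term from [f 0]. *)
Lemma cauchy_diffl (f h : nat -> rat) n :
  cauchy f h n.+1 = cauchy f h n
    + (cauchy (fun l => f l.+1 - f l) h n + f 0%N * h n).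
Proof.
rewrite /cauchy big_ord_recl subn0 [RHS]addrA [RHS]addrC; congr (_ + _).
rewrite -big_split; apply: eq_bigr => i _ /=.
rewrite /bump /= add1n (_ : n - i.+1 = n.-1 - i)%N; first by ring.
by have := ltn_ord i; lia.
Qed.

(** Each difference of [f] lowers its degree until [f] is zero; each summation undoing it costs one
    degree in the polynomial part only. *)
Lemma quasipoly_cauchy a b c f h : quasipoly 0 a f -> quasipoly b c h ->
  quasipoly b (a + c) (cauchy f h).
Proof.
elim: a f => [|a IHa] f fP hP.
  case: fP => [p [q []]]; rewrite !size_poly_leq0 => /eqP -> /eqP -> fE.
  apply: eq_quasipoly (quasipoly0 _ _) => n; rewrite /cauchy big1 // => l _.
  by rewrite fE !horner0 addr0 !mul0r.
rewrite addSn; apply: quasipoly_recur1 (cauchy_diffl f h) _.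
apply: quasipolyD; first exact: IHa (quasipoly_diff fP) hP.
by apply: quasipolyZ; apply: quasipoly_le hP => //; rewrite leq_addl.
Qed.

Lemma quasipoly_shift b f :
  quasipoly 0 b f -> quasipoly 0 b (fun n => f n.+1).
Proof.
move=> fP; apply: (@eq_quasipoly _ _ (fun n => f n + (f n.+1 - f n))).
  by move=> n; rewrite addrC subrK.
apply: quasipolyD => //.
by apply: quasipoly_le (quasipoly_diff fP) => //; rewrite leq_pred.
Qed.

(** * Degree bounds for the coefficients *)

Lemma quasipoly_gf k r : (2 <= k)%N -> quasipoly 0 r.+1 (gf_coef k r).
Proof.
have [d led] := ubnP r; elim: d r led k => // d IHd r led k k2.
have fS n : gf_coef k r n.+1 = gf_coef k r n + (if (r < k)%N then 0 else
   \sum_(a < (r - k).+1) cauchy (fun l => gf_coef k.+1 a l.+1) (gf_coef k (r - k - a)) n).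
  rewrite /gf_coef gf_rec coefD coefXnM; congr (_ + _); case: ifP => // _.
  exact: coef_cauchy.
(* For r < k the factor ['X^k] contributes nothing and the sequence is constant. *)
case: ltnP fS => rk fS; first exact: quasipoly_recur1 fS (quasipoly0 _ _).
apply: quasipoly_recur1 fS _; apply: quasipoly_sum => -[a lta] /=.
(* The sizes add up to r - k + 2, at most r exactly because k is at least 2; the summation then
   yields r + 1. *)
apply: (@quasipoly_le 0 (a.+1 + (r - k - a).+1)) => //; first by lia.
apply: quasipoly_cauchy; last by apply: IHd => //; lia.
by apply: quasipoly_shift; apply: IHd; lia.
Qed.

(** The argument is shifted because [gf0_rec] starts from index 1. *)
Lemma quasipoly_gf0 r : quasipoly r.+1 r (fun n => gf_coef 0 r n.+1).
Proof.
have [d led] := ubnP r; elim: d r led => // d IHd [|r] led.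
  have fS n : gf_coef 0 0 n.+2 = 2%:R * gf_coef 0 0 n.+1 + 0.
    by rewrite /gf_coef gf0_rec coefD coefXM mulr_natl coefMn mulr_natl.
  exact: quasipoly_recur2 fS (quasipoly0 _ _).
have fS n : gf_coef 0 r.+1 n.+2 = 2%:R * gf_coef 0 r.+1 n.+1 +
    \sum_(a < r.+1) cauchy (fun l => gf_coef 2 a l.+1)
                          (fun l => gf_coef 0 (r - a) l.+1) n.
  rewrite /gf_coef gf0_rec coefD coefXM mulr_natl coefMn mulr_natl; congr (_ + _).
  exact: coef_cauchy.
apply: (quasipoly_recur2 fS); apply: quasipoly_sum => -[a lta] /=.
(* The polynomial part has size a + 1 + (r - a) = r + 1; the exponential part has size at most r + 1
   and gains one from [quasipoly_recur2]. *)
apply: (@quasipoly_le (r - a).+1 (a.+1 + (r - a))); [by lia | by lia |].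
apply: quasipoly_cauchy; last by apply: IHd; lia.
by apply: quasipoly_shift; apply: quasipoly_gf.
Qed.

Theorem theorem3p1 (r : nat) :
  exists p q : {poly rat},
    [/\ (size p <= r.+1)%N,
        (size q <= r)%N &
        forall n : nat, (1 <= n)%N ->
          ((g r n)%:R = p.[n%:R] * 2%:R ^+ n + q.[n%:R] :> rat)%R].
Proof.
have [p [q [sp sq fE]]] := quasipoly_gf0 r.
have sX : size ('X - 1%:P : {poly rat}) = 2 by rewrite size_XsubC.
(* Undoes the index shift: n is replaced by n - 1, and 2^(n-1) is half of 2^n. *)
exists (2%:R^-1 *: (p \Po ('X - 1%:P))), (q \Po ('X - 1%:P)); split.
- by rewrite (leq_trans (size_scale_leq _ _)) // size_comp_poly2.
- by rewrite size_comp_poly2.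
case=> // n _; rewrite -coef_gf_g -/(gf_coef 0 r n.+1) fE.
have X1 : ('X - 1%:P).[n.+1%:R] = n%:R :> rat by rewrite hornerXsubC -natr1 addrK.
by rewrite hornerZ !horner_comp X1 exprS; field.
Qed.
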